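(* (1) Let $X$ be a Fréchet sequence space over $\mathbb{Z}$ in which the sequence $(e_j)_{j\in\mathbb{Z}}$ of canonical vectors is a basis, let $(\|\cdot\|_k)_{k\in\mathbb{N}}$ be an increasing sequence of seminorms that induces the topology of $X$, let $w=(w_j)_{j\in\mathbb{Z}}$ be a sequence of nonzero scalars, and suppose that the bilateral weighted forward shift $$F_w:(x_j)_{j\in\mathbb{Z}}\in X\mapsto (w_{j-1}x_{j-1})_{j\in\mathbb{Z}}\in X$$ is an invertible operator on $X$. Then $F_w$ is average expansive if and only if there exists $k\in\mathbb{N}$ such that $$\sup_{n\in\mathbb{N}}\Big(\frac1n\sum_{j=1}^n|w_0\cdots w_{j-1}|\,\|e_j\|_k\Big)=\infty\quad\text{or}\quad\sup_{n\in\mathbb{N}}\Big(\frac1n\sum_{j=1}^n\frac{\|e_{-j}\|_k}{|w_{-j}\cdots w_{-1}|}\Big)=\infty.$$ (2) In particular, if $X=\lambda_p(A,\mathbb{Z})$ is a Köthe sequence space, where $A=(a_{j,k})$ is a Köthe matrix on $\mathbb{Z}$ and $p\in\{0\}\cup[1,\infty)$, and $F_w$ is an invertible operator on $X$, then $F_w$ is average expansive if and only if there exists $k\in\mathbb{N}$ such that $$\sup_{n\in\mathbb{N}}\Big(\frac1n\sum_{j=1}^na_{j,k}\,|w_0\cdots w_{j-1}|\Big)=\infty\quad\text{or}\quad\sup_{n\in\mathbb{N}}\Big(\frac1n\sum_{j=1}^n\frac{a_{-j,k}}{|w_{-j}\cdots w_{-1}|}\Big)=\infty.$$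
   Context: $\mathbb{K}$ denotes $\mathbb{R}$ or $\mathbb{C}$, and $\mathbb{N}=\{1,2,3,\dots\}$. An operator on a locally convex (Hausdorff) space $X$ over $\mathbb{K}$ is a continuous linear map $X\to X$; it is invertible if it has a continuous inverse, and $GL(X)$ is the set of invertible operators. A Fréchet sequence space over $\mathbb{Z}$ is a Fréchet space $X$ that is a vector subspace of $\mathbb{K}^{\mathbb{Z}}$ such that the inclusion $X\to\mathbb{K}^{\mathbb{Z}}$ is continuous. The canonical vector $e_j$ has $j$-th coordinate $1$ and all other coordinates $0$. The sequence $(e_j)_{j\in\mathbb{Z}}$ is a basis of $X$ if each $e_j\in X$ and $x=\sum_{j=-\infty}^{\infty}x_je_j$ (convergence in $X$) for all $x=(x_j)\in X$. A Köthe matrix on $\mathbb{Z}$ is a family of scalars $A=(a_{j,k})_{j\in\mathbb{Z},k\in\mathbb{N}}$ such that for each $j$: $0\le a_{j,1}\le a_{j,2}\le\cdots$, and $a_{j,k}>0$ for some $k$. For $p\in[1,\infty)$, $\lambda_p(A,\mathbb{Z})=\{(x_j)\in\mathbb{K}^{\mathbb{Z}}:\sum_{j}|a_{j,k}x_j|^p<\infty\text{ for all }k\}$ with seminorms $\|x\|_k=(\sum_{j}|a_{j,k}x_j|^p)^{1/p}$. For $p=0$, $\lambda_0(A,\mathbb{Z})=\{(x_j)\in\mathbb{K}^{\mathbb{Z}}:\lim_{|j|\to\infty}a_{j,k}x_j=0\text{ for all }k\}$ with seminorms $\|x\|_k=\sup_{j}|a_{j,k}x_j|$. These are Fréchet sequence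 spaces over $\mathbb{Z}$ with basis $(e_j)$. Average expansivity: if the topology of $X$ is induced by a family $(\|\cdot\|_\alpha)_{\alpha\in I}$ of seminorms, $T\in GL(X)$ is average expansive if for each $x\in X\setminus\{0\}$ there exists $\alpha\in I$ such that $\sup_{n\in\mathbb{N}}\big(\frac{1}{2n+1}\sum_{j=-n}^{n}\|T^jx\|_\alpha\big)=\infty$. (This does not depend on the choice of the family; here one may use $(\|\cdot\|_k)_{k\in\mathbb{N}}$.) *)

(* Defs.v *)
From HB Require Import structures.
From mathcomp Require Import all_boot all_order all_algebra.
From mathcomp Require Import all_classical all_reals all_analysis.
From mathcomp Require Import complex.

Set Implicit Arguments.
Unset Strict Implicit.
Unset Printing Implicit Defensive.

Import Order.TTheory GRing.Theory Num.Theory.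
Import numFieldNormedType.Exports.

Local Open Scope classical_set_scope.
Local Open Scope ring_scope.

Variant scalar_field := RealScalars | ComplexScalars.

Definition scalars (R : realType) (b : scalar_field) : numFieldType :=
  match b with RealScalars => R | ComplexScalars => complex R end.

(* The norm of the numFieldType [complex R] takes its values in [complex R];
   [modulus] is the R-valued absolute value. *)
Definition modulus (R : realType) (b : scalar_field) : scalars R b -> R :=
  match b return scalars R b -> R with
  | RealScalars => fun x => `|x|
  | ComplexScalars => fun z => ComplexField.Normc.normc z
  end.

Section LocallyConvexSpaces.
Context (R : realType) (b : scalar_field).
Local Notation K := (scalars R b).

Definition seminorm (X : lmodType K) (p : X -> R) : Prop :=
  (forall x y, p (x + y) <= p x + p y) /\
  (forall (c : K) x, p (c *: x) = modulus c * p x).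

Definition induces_topology (X : tvsType K) (I : eqType) (p : I -> X -> R) :
    Prop :=
  forall (x : X) (U : set X), nbhs x U <->
    exists (D : seq I) (eps : R), 0 < eps /\
      forall y, (forall i, i \in D -> p i (y - x) < eps) -> U y.

(* The uniform structure of a tvsType is not required to be the
   translation-invariant one, so Cauchy filters are spelled out with
   differences rather than taken from the uniform structure. *)
Definition complete_tvs (X : tvsType K) : Prop :=
  forall F : set_system X, ProperFilter F ->
    (forall U : set X, nbhs 0 U ->
      exists2 A, F A & forall x y, A x -> A y -> U (x - y)) ->
    exists x : X, F --> x.

(* Metrizability of a locally convex Hausdorff space amounts to its topology
   being induced by a sequence of seminorms. *)
Definition frechet_space (X : tvsType K) : Prop :=
  [/\ hausdorff_space X,
      (exists2 p : nat -> X -> R,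
        (forall k, seminorm (p k)) & induces_topology p) &
      complete_tvs X].

Record invertible_operator (X : tvsType K) := InvertibleOperator {
  operator :> X -> X;
  inverse : X -> X;
  operator_linear : forall (c : K) (x y : X),
    operator (c *: x + y) = c *: operator x + operator y;
  operator_continuous : continuous operator;
  inverse_continuous : continuous inverse;
  operatorK : cancel operator inverse;
  inverseK : cancel inverse operator
}.

Definition operator_power (X : tvsType K) (T : invertible_operator X)
    (j : int) : X -> X :=
  match j with
  | Posz n => iter n T
  | Negz n => iter n.+1 (inverse T)
  end.

(* Supremum over n = 1, 2, ..., in the extended reals *)
Definition sup_pos (u : nat -> R) : \bar R :=
  ereal_sup [set (u n)%:E | n in [set n : nat | (0 < n)%N]].

(* [p] is meant to be a family of seminorms inducing the topology of [X]; the
   notion does not depend on which one. *)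
Definition average_expansive (X : tvsType K) (I : Type) (p : I -> X -> R)
    (T : invertible_operator X) : Prop :=
  forall x : X, x != 0 -> exists i : I,
    sup_pos (fun n =>
      ((2 * n).+1%:R)^-1 *
        \sum_(0 <= m < (2 * n).+1) p i (operator_power T (m%:Z - n%:Z) x))
    = +oo%E.

End LocallyConvexSpaces.

(* A topological vector space whose underlying vector space is the subspace
   S of K^Z; the inclusion is [\val]. *)
#[short(type="seqTvsType")]
HB.structure Definition SeqTvs (K : numFieldType) (S : pred (int -> K^o)) :=
  {X of GRing.SubLmodule K S X & Tvs K X}.

Section SequenceSpaces.
Context (R : realType) (b : scalar_field).
Local Notation K := (scalars R b).

Definition frechet_sequence_space (S : pred (int -> K^o))
    (X : seqTvsType S) : Prop :=
  frechet_space X /\ continuous (\val : X -> {ptws int -> K^o}).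

(* The bilateral series converges when its partial sums over -m <= j <= n do
   as m and n tend to infinity independently. *)
Definition canonical_basis (S : pred (int -> K^o)) (X : seqTvsType S)
    (e : int -> X) : Prop :=
  (forall j i : int, \val (e j) i = (i == j)%:R) /\
  (forall x : X,
    (fun mn : nat * nat =>
       \sum_(0 <= i < mn.1.+1) \val x (- i.+1%:Z) *: e (- i.+1%:Z)
       + \sum_(0 <= i < mn.2.+1) \val x i%:Z *: e i%:Z)
    @ filter_prod \oo \oo --> x).

Definition forward_shift (w : int -> K) (x : int -> K^o) : int -> K^o :=
  fun j => w (j - 1) * x (j - 1).

(* The index k of a Köthe matrix starts at 0 instead of 1. *)
Definition kothe_matrix (a : int -> nat -> R) : Prop :=
  (forall j k, 0 <= a j k <= a j k.+1) /\ (forall j, exists k, 0 < a j k).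

Definition kothe_space (p : R) (a : int -> nat -> R) : pred (int -> K^o) :=
  fun x => `[<
    if p == 0 then
      forall k (eps : R), 0 < eps -> exists N : nat,
        forall j : int, (N <= `|j|)%N -> a j k * modulus (x j) < eps
    else
      forall k,
        (\esum_(j in [set: int]) ((a j k * modulus (x j)) `^ p)%:E < +oo)%E >].

Definition kothe_seminorm (p : R) (a : int -> nat -> R) (k : nat)
    (x : int -> K^o) : R :=
  if p == 0 then sup [set a j k * modulus (x j) | j in [set: int]]
  else (fine (\esum_(j in [set: int]) ((a j k * modulus (x j)) `^ p)%:E))
         `^ p^-1.

End SequenceSpaces.

(* Main.v *)
Require Import Defs.
From HB Require Import structures.
From mathcomp Require Import all_boot all_order all_algebra.
From mathcomp Require Import all_classical all_reals all_analysis.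
From mathcomp Require Import complex ring lra zify.

Set Implicit Arguments.
Unset Strict Implicit.
Unset Printing Implicit Defensive.

Import Order.TTheory GRing.Theory Num.Theory.
Import numFieldNormedType.Exports.

Local Open Scope classical_set_scope.
Local Open Scope ring_scope.

(** Write [c_j] for the scalar with [F^j e_0 = c_j e_j], so that
    [|c_j| ||e_j||_k] is the [k]-th seminorm of the [j]-th orbit point of [e_0];
    the two averages of the criterion run over the orbit of [e_0] under [F] and
    under its inverse.

    If [F] is average expansive, the definition applied to [e_0] makes one of
    these averages unbounded, since the average over [-n..n] is controlled by
    the average over [1..n], the average over [-n..-1] and the term at [0].

    For the converse, [F] moves the ratios [x_j / c_j] without changing them
    ([operator_powerE]).  Hence a vector with [x_i != 0] has the coordinate
    [(x_i / c_i) c_(m+i)] at position [m+i] of [F^m x].  If the coordinate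
    projections [x |-> x_j e_j] are equicontinuous in [j], then [||F^m x||_l] is
    at least a fixed multiple of [||c_(m+i) e_(m+i)||_k]: the orbit of [x]
    dominates the orbit of [e_0] up to a shift of time by [i]
    ([orbit_norm_le]), and a bounded shift does not affect the unboundedness of
    averages ([sum_window]).  This gives [average_expansive_shift].

    Equicontinuity of the projections is the only place where the space
    matters.  For a basis of a Frechet space it follows from the uniform
    boundedness principle ([basis_terms_equicontinuous]), because the terms of
    a convergent bilateral series are bounded.  For a Koethe space it is
    the inequality [a_(j,k) |x_j| <= ||x||_k] ([kothe_coordinate_le]). *)

(** * The modulus of a scalar *)

Section Modulus.
Context (R : realType) (b : scalar_field).
Local Notation K := (scalars R b).

Lemma modulus_ge0 (z : K) : 0 <= modulus z.
Proof. by case: b z => z //=; case: z => x y /=; exact: sqrtr_ge0. Qed.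

Lemma modulusM (x y : K) : modulus (x * y) = modulus x * modulus y.
Proof. by case: b x y => x y /=; [exact: normrM|exact: Normc.normcM]. Qed.

Lemma modulus0 : modulus (0 : K) = 0.
Proof. by case: b => /=; [exact: normr0|exact: Normc.normc0]. Qed.

Lemma modulus1 : modulus (1 : K) = 1.
Proof. by case: b => /=; [exact: normr1|exact: Normc.normc1]. Qed.

Lemma modulus_eq0 (z : K) : modulus z = 0 -> z = 0.
Proof.
by case: b z => z /=; [move=> h; apply/normr0_eq0|exact: Normc.eq0_normc].
Qed.

Lemma modulusV (z : K) : modulus z^-1 = (modulus z)^-1.
Proof. by case: b z => z /=; [exact: normfV|exact: Normc.normcV]. Qed.

Lemma modulusN1 : modulus (- 1 : K) = 1.
Proof.
case: b => /=; first by rewrite normrN1.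
by rewrite oppr0 sqrrN expr1n expr0n addr0 sqrtr1.
Qed.

Lemma modulusD (x y : K) : modulus (x + y) <= modulus x + modulus y.
Proof. by case: b x y => x y /=; [exact: ler_normD|exact: le_normcD]. Qed.

Lemma modulus_gt0 (z : K) : z != 0 -> 0 < modulus z.
Proof.
move=> z0; rewrite lt_neqAle modulus_ge0 andbT eq_sym.
by apply: contra z0 => /eqP/modulus_eq0 ->.
Qed.

Lemma modulus_surj (t : R) : 0 <= t -> exists z : K, modulus z = t.
Proof.
move=> t0; case: b => /=; first by exists t; rewrite /= ger0_norm.
by exists (t%:C)%C; rewrite /= expr0n addr0 sqrtr_sqr ger0_norm.
Qed.

(** Neighbourhoods in the scalar field are defined by its own norm, which takes
    values in [K]; this lemma translates them to the [R]-valued modulus. *)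
Lemma modulus_nbhs (z : K^o) (eps : R) :
  0 < eps -> \forall y \near z, modulus (y - z) < eps.
Proof.
move=> e0; case: b z => z; apply/nbhs_ballP => /=.
  exists eps => //= y; rewrite -ball_normE /= => h.
  by rewrite distrC.
exists (eps%:C)%C => /=; first by rewrite ltcR.
move=> y; rewrite -ball_normE /= => h.
by rewrite distrC in h; rewrite -ltcR.
Qed.

Lemma modulus_continuous : continuous (@modulus R b : K^o -> R).
Proof.
move=> z; apply/(@cvgrPdist_lt _ R^o _ (nbhs z) (nbhs_filter z)) => eps e0.
apply: (@filterS _ (nbhs z) _ _ _ _ (modulus_nbhs z e0)) => y h.
have h1 := modulusD (y - z) z.
have h2 := modulusD (-1 * (y - z)) y.
rewrite modulusM modulusN1 mul1r in h2.
have e : -1 * (y - z) + y = z by rewrite mulN1r opprB subrK.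
rewrite subrK in h1; rewrite e in h2.
rewrite ltr_norml; apply/andP; split; lra.
Qed.

End Modulus.

(** * Seminorms and uniform boundedness *)

Section Seminorms.
Context (R : realType) (b : scalar_field).
Local Notation K := (scalars R b).

Section OneSeminorm.
Context (X : lmodType K) (p : X -> R) (psn : seminorm p).

Lemma seminormD x y : p (x + y) <= p x + p y.
Proof. by case: psn. Qed.

Lemma seminormZ (c : K) x : p (c *: x) = modulus c * p x.
Proof. by case: psn. Qed.

Lemma seminorm0 : p 0 = 0.
Proof. by rewrite -(scale0r (0 : X)) seminormZ modulus0 mul0r. Qed.

Lemma seminormN x : p (- x) = p x.
Proof. by rewrite -scaleN1r seminormZ modulusN1 mul1r. Qed.

Lemma seminorm_ge0 x : 0 <= p x.
Proof.
have := seminormD x (- x); rewrite subrr seminorm0 seminormN; lra.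
Qed.

Lemma seminorm_distC x y : p (x - y) = p (y - x).
Proof. by rewrite -seminormN opprB. Qed.

Lemma seminorm_dist_triangle y x z : p (x - z) <= p (x - y) + p (y - z).
Proof. by have := seminormD (x - y) (y - z); rewrite addrA subrK. Qed.

End OneSeminorm.

Section SequenceOfSeminorms.
Context (X : tvsType K) (p : nat -> X -> R).
Hypotheses (psn : forall k, seminorm (p k))
  (pS : forall k x, p k x <= p k.+1 x) (pind : induces_topology p).

Lemma seminorm_homo x k l : (k <= l)%N -> p k x <= p l x.
Proof.
move=> kl; rewrite -(subnK kl); elim: (l - k)%N => // n ih.
exact: le_trans ih (pS _ _).
Qed.

(** The largest index of a finite family of seminorms dominates the whole
    family, so one seminorm suffices to describe a neighbourhood. *)
Lemma nbhs_seminormP (x : X) (U : set X) :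
  nbhs x U <-> exists k (eps : R),
    0 < eps /\ forall y, p k (y - x) < eps -> U y.
Proof.
rewrite pind; split => [[D [eps [e0 h]]]|[k [eps [e0 h]]]]; last first.
  exists [:: k], eps; split => // y hy.
  by apply: h; apply: hy; rewrite inE.
exists (\max_(i <- D) i)%N, eps; split => // y hy; apply: h => i iD.
by apply: le_lt_trans hy; apply/seminorm_homo/leq_bigmax_seq.
Qed.

Lemma complete_seminormP (u : nat -> X) : complete_tvs X ->
  (forall k (eps : R), 0 < eps -> exists N, forall m n, (N <= m)%N ->
    (N <= n)%N -> p k (u m - u n) < eps) ->
  exists x, forall k (eps : R), 0 < eps ->
    exists n, forall m, (n <= m)%N -> p k (u m - x) < eps.
Proof.
move=> Xc uC; have [|x ux] := Xc (u @ \oo) _.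
  move=> U /nbhs_seminormP[k [eps [e0 hU]]].
  have [N hN] := uC k _ e0.
  exists [set u m | m in [set m | (N <= m)%N]].
    by exists N => // m /= Nm; exists m.
  move=> _ _ [m Nm <-] [n Nn <-]; apply: hU; rewrite subr0; exact: hN.
exists x => k eps e0.
have /ux[n _ hn] : nbhs x [set y | p k (y - x) < eps].
  by apply/nbhs_seminormP; exists k, eps.
by exists n => m /hn.
Qed.

(** A Baire category argument, by nested balls.  If the family [q] is bounded on
    some ball, rescaling gives the estimate.  Otherwise every ball contains a
    point at which some [q i] exceeds [N], hence, by continuity of [q i], a
    smaller ball on all of which [q i] exceeds [N].  Iterating over [N] gives a
    decreasing sequence of balls; by completeness they have a common point, at
    which the family is unbounded. *)
Lemma uniform_boundedness (I : Type) (q : I -> X -> R) : complete_tvs X ->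
  (forall i, seminorm (q i)) -> (forall i, continuous (q i)) ->
  (forall x, exists B, forall i, q i x <= B) ->
  exists k C, 0 < C /\ forall i x, q i x <= C * p k x.
Proof.
move=> Xc qsn qc qB.
have [[k [eps [B [e0 hB]]]]|nbdd] := pselect (exists k (eps B : R),
    0 < eps /\ forall i x, p k x < eps -> q i x <= B).
  pose C := 2 * (`|B| + 1) / eps.
  have C0 : 0 < C by rewrite !mulr_gt0 ?invr_gt0 ?ltr_wpDl.
  exists k, C; split => // i x; apply/ler_addgt0Pr => d d0.
  have s0 : 0 < p k x + d / C.
    by rewrite ltr_wpDl ?divr_gt0 ?(seminorm_ge0 (psn k)).
  (* x is rescaled into the ball of radius eps on which q i is bounded; the
     summand d / C avoids a division by zero when p k x = 0. *)
  pose t := eps / 2 / (p k x + d / C).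
  have t0 : 0 < t by rewrite !mulr_gt0 ?invr_gt0.
  have [z zt] := modulus_surj b (ltW t0).
  have := hB i (z *: x); rewrite !seminormZ // zt => h.
  have {}h : t * q i x <= B.
    apply: h; rewrite /t -mulrA -mulrA; apply: (@le_lt_trans _ _ (eps * 2^-1)).
      rewrite ler_pM2l // -[leRHS]mulr1 ler_pM2l ?invr_gt0 // mulrC.
      by rewrite ler_pdivrMr // mul1r lerDl divr_ge0 ?ltW.
    by rewrite gtr_pMr //; lra.
  have -> : C * p k x + d = C * (p k x + d / C).
    by rewrite mulrDr mulrCA divff ?mulr1 ?gt_eqF.
  have -> : C * (p k x + d / C) = (`|B| + 1) / t.
    move: (gt_eqF s0); rewrite /t; set S := p k x + _ => S0.
    by rewrite /C; field; rewrite S0 gt_eqF.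
  rewrite ler_pdivlMr // mulrC; apply: (le_trans h).
  by rewrite (le_trans (ler_norm _)) // lerDl.
exfalso.
pose ball x k (eps : R) := [set y : X | p k (y - x) <= eps].
(* A state consists of the centre, the seminorm and the radius of a ball. *)
have step N (s : X * nat * R) : exists s' : X * nat * R, 0 < s.2 ->
    [/\ 0 < s'.2, s'.2 <= N.+1%:R^-1, (N <= s'.1.2)%N,
      ball s'.1.1 s'.1.2 s'.2 `<=` ball s.1.1 s.1.2 s.2 &
      forall y, ball s'.1.1 s'.1.2 s'.2 y -> exists i, N%:R < q i y].
  case: s => -[x k] eps /=.
  have [e0|ne0] := pselect (0 < eps); last by exists (x, k, eps).
  have [x' xx' [i ix']] : exists2 x', p k (x' - x) < eps / 2 &
      exists i, N%:R < q i x'.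
    (* otherwise q i is at most N on a ball around x, hence at most
       N + q i x on the ball of the same radius around the origin *)
    apply: contrapT => nx'; apply: nbdd.
    have [Bx hBx] := qB x.
    exists k, (eps / 2), (N%:R + Bx); split; first by rewrite divr_gt0.
    move=> i y hy.
    have : q i (y + x) <= N%:R.
      rewrite leNgt; apply/negP => h; apply: nx'; exists (y + x); last by exists i.
      by rewrite addrK.
    have := seminormD (qsn i) (y + x) (- x).
    rewrite addrK (seminormN (qsn i)); have := hBx i; lra.
  have [l [d [d0 hd]]] : exists l (d : R),
      0 < d /\ forall y, p l (y - x') < d -> N%:R < q i y.
    apply/nbhs_seminormP.
    have := qc i x' [set r | N%:R < r]; apply.
    exact: lt_nbhsr.
  pose d' := Num.min (d / 2) (Num.min (eps / 2) N.+1%:R^-1).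
  have [d'1 d'2 d'3] : [/\ d' <= d / 2, d' <= eps / 2 & d' <= N.+1%:R^-1].
    by rewrite /d'; split; rewrite !ge_min lexx ?orbT.
  exists (x', maxn N (maxn k l), d') => /= _; split => //.
  - by rewrite !lt_min invr_gt0 ltr0n /= andbT !divr_gt0.
  - exact: leq_maxl.
  - move=> y; rewrite /ball /= => hy.
    have h : p k (y - x') <= d'.
      by apply: le_trans hy; apply: seminorm_homo; lia.
    have := seminorm_dist_triangle (psn k) x' y x; lra.
  - move=> y; rewrite /ball /= => hy; exists i; apply: hd.
    have h : p l (y - x') <= d'.
      by apply: le_trans hy; apply: seminorm_homo; lia.
    lra.
have [f hf] := choice (fun Ns : nat * _ => step Ns.1 Ns.2).
pose s := fix s n : X * nat * R :=
  if n is m.+1 then f (m, s m) else (0, 0%N, 1).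
have s0 n : 0 < (s n).2.
  by elim: n => [|n ih] //=; have [] := hf (n, s n) ih.
pose Bn n := ball (s n).1.1 (s n).1.2 (s n).2.
have BnS m n : (m <= n)%N -> Bn n `<=` Bn m.
  move=> mn; rewrite -(subnK mn); elim: (n - m)%N => [|j ih] //.
  rewrite addSn; apply: subset_trans ih.
  by have [] := hf ((j + m)%N, s (j + m)%N) (s0 _).
have Bnc n : Bn n (s n).1.1.
  by rewrite /Bn /ball /= subrr seminorm0 // ltW.
pose u n := (s n).1.1.
(* The centres form a Cauchy sequence: the radii tend to 0 while the indices
   of the seminorms tend to infinity. *)
have [|x hx] := @complete_seminormP u Xc.
  move=> k eps e0.
  have [N hN] : exists N, (k <= N)%N /\ N.+1%:R^-1 < eps / 2.
    have e2 : 0 < (eps / 2)^-1 by rewrite invr_gt0 divr_gt0.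
    have hh := archi_boundP (ltW e2).
    set A := Num.bound _ in hh.
    exists (maxn k A); split; first exact: leq_maxl.
    rewrite invf_plt ?posrE ?divr_gt0 //; apply: (lt_le_trans hh).
    by rewrite ler_nat; lia.
  case: hN => kN Ne.
  have [_ sN kN' _ _] := hf (N, s N) (s0 _).
  have aux m : (N.+1 <= m)%N -> p k (u m - u N.+1) < eps / 2.
    move=> Nm; have := BnS _ _ Nm _ (Bnc m); rewrite /Bn /ball /= => h.
    apply: (le_lt_trans (seminorm_homo _ (leq_trans kN kN'))).
    by apply: (le_lt_trans h); apply: le_lt_trans Ne.
  exists N.+1 => m n /aux hm /aux hn.
  apply: (le_lt_trans (seminorm_dist_triangle (psn k) (u N.+1) _ _)).
  by rewrite (seminorm_distC (psn k) (u N.+1)) [ltRHS]splitr ltrD.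
have xB n : Bn n x.
  rewrite /Bn /ball /=; apply/ler_addgt0Pr => d d0.
  have [m hm] := hx (s n).1.2 d d0.
  have h1 := hm _ (leq_maxl m n).
  have h2 := BnS _ _ (leq_maxr m n) _ (Bnc _).
  have h3 := seminorm_dist_triangle (psn (s n).1.2)
    (u (maxn m n)) x (s n).1.1.
  rewrite (seminorm_distC (psn _) x (u (maxn m n))) in h3.
  rewrite /Bn /ball /= in h2; rewrite /u in h1 h3; lra.
have [B hB] := qB x.
pose N := Num.bound `|B|.
have hN : `|B| < N%:R by apply: archi_boundP.
have [_ _ _ _ /(_ x (xB N.+1))[i /=]] := hf (N, s N) (s0 _).
by move/(lt_trans hN); rewrite ltNge (le_trans (hB i)) // ler_norm.
Qed.

End SequenceOfSeminorms.
End Seminorms.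

(** * Averages over bilateral orbits *)

Section BilateralSums.
Context (R : realType).

Lemma sup_pos_pinftyP (u : nat -> R) :
  sup_pos u = +oo%E <-> forall M, exists2 n, (0 < n)%N & M < u n.
Proof.
split => [h M|h].
  have /ereal_sup_gt[_ [n /= n0 <-] Mn] : (M%:E < sup_pos u)%E by rewrite h ltry.
  by exists n; rewrite -?lte_fin.
apply: eq_infty => M.
have [n n0 Mn] := h M; apply: le_trans (ereal_sup_ubound _); last by exists n.
by rewrite lee_fin ltW.
Qed.

Lemma sum_symmetric (f : int -> R) n :
  \sum_(0 <= m < (2 * n).+1) f (m%:Z - n%:Z) =
  f 0 + \sum_(1 <= j < n.+1) f j%:Z + \sum_(1 <= j < n.+1) f (- j%:Z).
Proof.
rewrite (@big_cat_nat _ _ _ n) //=; last lia.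
rewrite [in X in _ + X]big_ltn; last lia.
rewrite subrr [LHS]addrC; congr (_ + _ + _).
- rewrite -{1}(add0n n.+1) big_addn big_add1 /=.
  rewrite (_ : ((2 * n).+1 - n.+1 = n)%N); last lia.
  by apply: eq_bigr => j _; congr f; lia.
- rewrite big_nat_rev big_add1 /=; apply: eq_big_nat => i /andP[_ ni].
  by congr f; lia.
Qed.

(** The orbit average of a vector is centred at a shifted index [i]; it still
    covers any window of consecutive indices inside [i - n .. i + n]. *)
Lemma sum_window (g : int -> R) (i s : int) (N n : nat) :
  (forall j, 0 <= g j) -> i - n%:Z <= s -> s + N%:Z <= i + n%:Z + 1 ->
  \sum_(0 <= l < N) g (s + l%:Z) <=
  \sum_(0 <= m < (2 * n).+1) g (m%:Z - n%:Z + i).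
Proof.
move=> g0 h1 h2; pose d := absz (s - (i - n%:Z))%R.
have dE : d%:Z = s - (i - n%:Z) by rewrite /d; lia.
clearbody d.
rewrite [leRHS](@big_cat_nat _ _ _ d) //=; last lia.
rewrite [X in _ + X](@big_cat_nat _ _ _ (d + N)) //=; [|lia|lia].
apply: (@le_trans _ _ (\sum_(d <= m < d + N) g (m%:Z - n%:Z + i))).
  rewrite -{1}(add0n d) big_addn addKn le_eqVlt; apply/orP; left; apply/eqP.
  by apply: eq_bigr => l _; congr g; lia.
by rewrite addrA -addrA [leRHS]addrC -addrA lerDl addr_ge0 ?sumr_ge0.
Qed.

End BilateralSums.

(** * Weighted shifts *)

Section Shift.
Context (R : realType) (b : scalar_field).
Local Notation K := (scalars R b).

(** The scalars [c_j] such that the [j]-th power of the shift with weights [w]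
    sends [e_0] to [c_j e_j]. *)
Definition orbit_coef (w : int -> K) (j : int) : K :=
  match j with
  | Posz n => \prod_(0 <= i < n) w i%:Z
  | Negz n => (\prod_(1 <= i < n.+2) w (- i%:Z))^-1
  end.

Section OrbitCoef.
Context (w : int -> K) (w0 : forall j, w j != 0).

Lemma orbit_coef_neq0 j : orbit_coef w j != 0.
Proof.
by case: j => n /=; rewrite ?invr_eq0 prodf_seq_neq0; apply/allP => i _ /=.
Qed.

Lemma orbit_coefS j : orbit_coef w (j + 1) = w j * orbit_coef w j.
Proof.
case: j => n.
  by rewrite -PoszD addn1 /= big_nat_recr //= mulrC.
case: n => [|n].
  rewrite /= big_nat1 big_nil.
  have -> : w (-1) = w (Negz 0) by [].
  by rewrite divff.
have -> : Negz n.+1 + 1 = Negz n by lia.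
rewrite [in RHS]/= big_nat_recr //= invfM mulrCA.
have -> : w (- n.+2%:Z) = w (Negz n.+1) by congr w; lia.
by rewrite divff ?mulr1.
Qed.

End OrbitCoef.

Context (S : pred (int -> K^o)) (X : seqTvsType S) (w : int -> K)
  (F : invertible_operator X).
Hypotheses (w0 : forall j, w j != 0)
  (Fw : forall x : X, \val (F x) = forward_shift w (\val x)).

Lemma shiftE x j : (\val (F x) : int -> K) (j + 1) = w j * (\val x : int -> K) j.
Proof. by rewrite Fw /forward_shift addrK. Qed.

(** The coordinates of [F x] and the coefficients [orbit_coef w] satisfy the same
    first-order recursion, so their ratio is carried along unchanged. *)
Lemma operator_powerE x (m j : int) :
  (\val (operator_power F m x) : int -> K) (m + j) / orbit_coef w (m + j) =
  (\val x : int -> K) j / orbit_coef w j.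
Proof.
have FE y i : (\val (F y) : int -> K) (i + 1) / orbit_coef w (i + 1) =
    (\val y : int -> K) i / orbit_coef w i.
  by rewrite shiftE orbit_coefS // invfM mulrACA divff ?mul1r.
case: m => n /=.
  elim: n j => [|n ih] j; first by rewrite add0r.
  by rewrite iterS -ih (_ : n.+1%:Z + j = n%:Z + j + 1) ?FE //; lia.
have FVE y i : (\val (inverse F y) : int -> K) (i - 1) / orbit_coef w (i - 1) =
    (\val y : int -> K) i / orbit_coef w i.
  by rewrite -FE inverseK subrK.
elim: n j => [|n ih] j.
  by rewrite (_ : Negz 0 + j = j - 1) ?FVE //; lia.
by rewrite -ih (_ : Negz n.+1 + j = Negz n + j - 1) ?FVE //; lia.
Qed.

(** The number [h k j] stands for the [k]-th seminorm of [e_j].  The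
    last hypothesis, equicontinuity of the coordinate projections, is the one
    that is verified by different means in general Frechet sequence spaces and
    in Koethe spaces. *)
Context (e : int -> X) (p : nat -> X -> R) (h : nat -> int -> R).
Hypotheses (eE : forall j i : int, \val (e j) i = (i == j)%:R)
  (pZe : forall k (c : K) j, p k (c *: e j) = modulus c * h k j)
  (p_ge0 : forall k x, 0 <= p k x)
  (ph : forall k, exists l C, 0 < C /\
    forall x j, modulus ((\val x : int -> K) j) * h k j <= C * p l x).


Lemma weight_ge0 k j : 0 <= h k j.
Proof. by have := p_ge0 k (1 *: e j); rewrite pZe modulus1 mul1r. Qed.

Definition orbit_norm k (j : int) := modulus (orbit_coef w j) * h k j.

Lemma orbit_norm_ge0 k j : 0 <= orbit_norm k j.
Proof. by rewrite mulr_ge0 ?modulus_ge0 ?weight_ge0. Qed.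

Lemma operator_power_e0 m : operator_power F m (e 0) = orbit_coef w m *: e m.
Proof.
apply/val_inj/funext => j.
have := operator_powerE (e 0) m (j - m).
rewrite (addrC m) subrK GRing.valZ fctE eE => hj.
apply: (mulIf (x := (orbit_coef w j)^-1)).
  by rewrite invr_eq0 orbit_coef_neq0.
rewrite hj eE subr_eq0; case: eqVneq => [->|jm].
  by rewrite subrr /= big_nil invr1 !mulr1 /GRing.scale /= mulr1
    divff ?orbit_coef_neq0.
by rewrite scaler0 !mul0r.
Qed.

Lemma orbit_normE k m : p k (operator_power F m (e 0)) = orbit_norm k m.
Proof. by rewrite operator_power_e0 pZe. Qed.

(** The orbit of [x] dominates the orbit of [e_0], up to a shift of time and a
    constant: by equicontinuity, [F^m x] is bounded below by its coordinate at
    [m + i], which is a fixed multiple of [orbit_coef w (m + i)]. *)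
Lemma orbit_norm_le k (x : X) (i : int) : (\val x : int -> K) i != 0 ->
  exists l D, 0 < D /\
    forall m, D * orbit_norm k (m + i) <= p l (operator_power F m x).
Proof.
move=> xi; have [l [C [C0 hC]]] := ph k.
pose d := modulus ((\val x : int -> K) i / orbit_coef w i).
have d0 : 0 < d by rewrite modulus_gt0 // mulf_neq0 ?invr_eq0 ?orbit_coef_neq0.
exists l, (d / C); split; first exact: divr_gt0.
move=> m; rewrite mulrAC ler_pdivrMr // [leRHS]mulrC.
apply: le_trans (hC _ (m + i)).
rewrite /d -(operator_powerE x m i) /orbit_norm mulrA -modulusM divfK //.
exact: orbit_coef_neq0.
Qed.

Lemma average_expansive_orbit_norm : average_expansive p F <->
  exists k,
    sup_pos (fun n => n%:R^-1 * \sum_(1 <= j < n.+1) orbit_norm k j%:Z)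
      = +oo%E \/
    sup_pos (fun n => n%:R^-1 * \sum_(1 <= j < n.+1) orbit_norm k (- j%:Z))
      = +oo%E.
Proof.
split => [ae|[k hk] x x0].
  have e00 : e 0 != 0.
    apply/eqP => e0; have := eE 0 0; rewrite e0 GRing.val0 eqxx.
    by move/eqP; rewrite eq_sym oner_eq0.
  have [k /sup_pos_pinftyP hk] := ae _ e00.
  exists k; apply: contrapT => /not_orP[nA nB].
  have bounded (u : nat -> R) :
      sup_pos u <> +oo%E -> exists M, forall n, (0 < n)%N -> u n <= M.
    move=> nu; apply: contrapT => nM; apply: nu.
    apply/sup_pos_pinftyP => M; apply: contrapT => nn; apply: nM.
    exists M => n n0; rewrite leNgt; apply/negP => Mn; apply: nn.
    by exists n.
  have [A hA] := bounded _ nA; have [B hB] := bounded _ nB.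
  have [n n0] := hk (`|A| + `|B| + orbit_norm k 0).
  apply/negP; rewrite -leNgt.
  rewrite (eq_bigr (fun m : nat => orbit_norm k (m%:Z - n%:Z))); last first.
    by move=> m _; rewrite orbit_normE.
  rewrite sum_symmetric mulrC ler_pdivrMr ?ltr0n //.
  have n0' : 0 < n%:R :> R by rewrite ltr0n.
  have := hA n n0; rewrite mulrC ler_pdivrMr // => {}hA.
  have := hB n n0; rewrite mulrC ler_pdivrMr // => {}hB.
  have := ler_norm A; have := ler_norm B.
  have := normr_ge0 A; have := normr_ge0 B; have := orbit_norm_ge0 k 0.
  have -> : (2 * n).+1%:R = 2 * n%:R + 1 :> R by rewrite -natr1 natrM.
  nra.
have [i xi] : exists i, (\val x : int -> K) i != 0.
  apply: contrapT => nx; move/eqP: x0; apply.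
  apply/val_inj; rewrite GRing.val0; apply/funext => i /=.
  by apply/eqP; apply: contrapT => /negP xi; apply: nx; exists i.
have [l [D [D0 hD]]] := orbit_norm_le k xi.
exists l; apply/sup_pos_pinftyP => M.
(* The hypothesis provides windows of N consecutive orbit norms, 1 .. N or
   -N .. -1, of large average.  Both lie in the symmetric window of radius
   n = N + |i| around i, and 2 n + 1 <= N (2 |i| + 3) because N > 0. *)
have window (N : nat) (s : int) : (0 < N)%N -> s = 1 \/ s = - N%:Z ->
    (`|M| * (2 * `|i|%N + 3)%:R / D) < N%:R^-1 *
      \sum_(0 <= t < N) orbit_norm k (s + t%:Z) ->
    exists2 n, (0 < n)%N & M < ((2 * n).+1%:R)^-1 *
      \sum_(0 <= m < (2 * n).+1) p l (operator_power F (m%:Z - n%:Z) x).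
  move=> N0 hs hN; exists (N + `|i|)%N; first by rewrite addn_gt0 N0.
  set n := (N + `|i|)%N.
  have N0' : 0 < N%:R :> R by rewrite ltr0n.
  rewrite ltr_pdivlMl ?ltr0n //.
  rewrite ltr_pdivlMl // mulrA ltr_pdivrMr // in hN.
  have h1 : \sum_(0 <= t < N) orbit_norm k (s + t%:Z) <=
      \sum_(0 <= m < (2 * n).+1) orbit_norm k (m%:Z - n%:Z + i).
    apply: sum_window; first exact: orbit_norm_ge0.
    - by rewrite /n; case: hs => ->; lia.
    - by rewrite /n; case: hs => ->; lia.
  have h2 : \sum_(0 <= m < (2 * n).+1) orbit_norm k (m%:Z - n%:Z + i) * D <=
      \sum_(0 <= m < (2 * n).+1) p l (operator_power F (m%:Z - n%:Z) x).
    by apply: ler_sum => m _; rewrite mulrC.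
  rewrite -mulr_suml in h2; apply: lt_le_trans h2.
  apply: lt_le_trans (ler_wpM2r (ltW D0) h1).
  apply: le_lt_trans hN.
  apply: (@le_trans _ _ ((2 * n).+1%:R * `|M|)).
    by rewrite ler_wpM2l // ler_norm.
  by rewrite mulrCA mulrC ler_wpM2l // -natrM ler_nat /n; nia.
case: hk => /sup_pos_pinftyP/(_ (`|M| * (2 * `|i|%N + 3)%:R / D))[N N0 hN].
  apply: (window N 1) => //; first by left.
  congr (_ < _ * _): hN; rewrite big_add1 /=.
  by apply: eq_bigr => t _; congr (orbit_norm _ _); lia.
apply: (window N (- N%:Z)) => //; first by right.
congr (_ < _ * _): hN; rewrite big_nat_rev big_add1 /=.
apply: eq_big_nat => t /andP[_ tN].
by congr (orbit_norm _ _); lia.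
Qed.

Theorem average_expansive_shift : average_expansive p F <->
  exists k,
    sup_pos (fun n => n%:R^-1 * \sum_(1 <= j < n.+1)
      modulus (\prod_(0 <= i < j) w i%:Z) * h k j%:Z) = +oo%E \/
    sup_pos (fun n => n%:R^-1 * \sum_(1 <= j < n.+1)
      h k (- j%:Z) / modulus (\prod_(1 <= i < j.+1) w (- i%:Z))) = +oo%E.
Proof.
rewrite average_expansive_orbit_norm.
suff negE k : (fun n => n%:R^-1 * \sum_(1 <= j < n.+1) orbit_norm k (- j%:Z)) =
    (fun n => n%:R^-1 * \sum_(1 <= j < n.+1)
      h k (- j%:Z) / modulus (\prod_(1 <= i < j.+1) w (- i%:Z))).
  by split => -[k hk]; exists k; move: hk; rewrite negE.
apply/funext => n; congr (_ * _); apply: eq_big_nat => -[//|j] _.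
rewrite /orbit_norm (_ : - j.+1%:Z = Negz j); last lia.
by rewrite modulusV mulrC.
Qed.

End Shift.

(** * Bases of Frechet sequence spaces *)

Section CanonicalBasis.
Context (R : realType) (b : scalar_field).
Local Notation K := (scalars R b).
Context (S : pred (int -> K^o)) (X : seqTvsType S) (e : int -> X)
  (p : nat -> X -> R).
Hypotheses (Xseq : frechet_sequence_space X) (eb : canonical_basis e)
  (psn : forall k, seminorm (p k)) (pS : forall k x, p k x <= p k.+1 x)
  (pind : induces_topology p).

Lemma coordinate_continuous (j : int) :
  continuous (fun x : X => modulus ((\val x : int -> K) j)).
Proof.
case: Xseq => _ vc x.
apply: (@continuous_comp X K^o R^o (fun x : X => (\val x : int -> K^o) j)
  (@modulus R b)); last exact: modulus_continuous.
apply: (@continuous_comp X {ptws int -> K^o} K^o \val (fun f => f j)).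
  exact: vc.
exact: (@proj_continuous int (fun=> K^o) j).
Qed.

(** Two consecutive partial sums of the basis expansion are eventually close to
    [x], which bounds their difference, a single term.  Independence of the two
    ends of the bilateral sum allows freezing one end while the other moves. *)
Lemma basis_terms_bounded k (x : X) :
  exists B, forall j, p k ((\val x : int -> K) j *: e j) <= B.
Proof.
case: eb => _ /(_ x) cx.
have := cx [set y | p k (y - x) < 1]; case.
  by apply/(nbhs_seminormP pS pind); exists k, 1; split.
case=> P Q /= [[M _ hM] [N _ hN]] hPQ.
set t := fun j => (\val x : int -> K) j *: e j.
pose sneg m := \sum_(0 <= i < m.+1) t (- i.+1%:Z).
pose spos n := \sum_(0 <= i < n.+1) t i%:Z.
have close m n : (M <= m)%N -> (N <= n)%N -> p k (sneg m + spos n - x) < 1.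
  move=> Mm Nn; apply: (hPQ (m, n)); split; [exact: hM|exact: hN].
have two y z : p k (y - x) < 1 -> p k (z - x) < 1 -> p k (y - z) <= 2.
  move=> hy hz; have := seminorm_dist_triangle (psn k) x y z.
  rewrite (seminorm_distC (psn k) x z); lra.
pose Bp := \sum_(0 <= i < N.+1) p k (t i%:Z).
pose Bn := \sum_(0 <= i < M.+1) p k (t (- i.+1%:Z)).
have psn0 y : 0 <= p k y := seminorm_ge0 (psn k) y.
have Bp0 : 0 <= Bp by apply: sumr_ge0 => i _.
have Bn0 : 0 <= Bn by apply: sumr_ge0 => i _.
have head (f : nat -> R) a i : (forall i, 0 <= f i) -> (i < a)%N ->
    f i <= \sum_(0 <= l < a) f l.
  move=> f0 ia; rewrite big_mkord (bigD1 (Ordinal ia)) //= lerDl.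
  exact: sumr_ge0.
exists (2 + Bp + Bn) => -[n|m]; rewrite -/(t _).
  have [nN|Nn] := leqP n N.
    have := @head (fun i => p k (t i%:Z)) N.+1 n (fun=> psn0 _) nN.
    rewrite -/Bp; lra.
  case: n Nn => // n Nn.
  have := two _ _ (close M n.+1 (leqnn _) (ltnW Nn)) (close M n (leqnn _) Nn).
  rewrite opprD addrACA subrr add0r /spos big_nat_recr //= addrC addKr; lra.
rewrite (_ : Negz m = - m.+1%:Z); last lia.
have [mM|Mm] := leqP m M.
  have := @head (fun i => p k (t (- i.+1%:Z))) M.+1 m (fun=> psn0 _) mM.
  rewrite -/Bn; lra.
case: m Mm => // m Mm.
have := two _ _ (close m.+1 N (ltnW Mm) (leqnn _)) (close m N Mm (leqnn _)).
rewrite opprD addrACA subrr addr0 /sneg big_nat_recr //= addrC addKr; lra.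
Qed.

Lemma basis_terms_equicontinuous k : exists l C, 0 < C /\
  forall x j, modulus ((\val x : int -> K) j) * p k (e j) <= C * p l x.
Proof.
have [[_ _ Xc] _] := Xseq.
pose q j (x : X) := modulus ((\val x : int -> K) j) * p k (e j).
have [||x|l [C [C0 hC]]] := @uniform_boundedness R b X p psn pS pind int q Xc.
- move=> j; split => [x y|c x]; rewrite /q.
    rewrite GRing.valD -mulrDl ler_wpM2r ?(seminorm_ge0 (psn k)) //.
    exact: modulusD.
  by rewrite GRing.valZ modulusM mulrA.
- move=> j x; apply: (@cvgMl _ X (nbhs x) _ (fun x : X => modulus _)).
  exact: coordinate_continuous.
- have [B hB] := basis_terms_bounded k x.
  by exists B => j; rewrite /q -(seminormZ (psn k)).
by exists l, C; split => // x j; apply: hC.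
Qed.

End CanonicalBasis.

(** * Koethe sequence spaces *)

Section KotheSpaces.
Context (R : realType) (b : scalar_field).
Local Notation K := (scalars R b).
Context (p : R) (a : int -> nat -> R).
Hypotheses (p01 : p = 0 \/ 1 <= p) (aK : kothe_matrix a).

Let a_ge0 j k : 0 <= a j k.
Proof. by case: aK => /(_ j k)/andP[]. Qed.

Let p_neq0 : p != 0 -> 1 <= p.
Proof. by case: p01 => // ->; rewrite eqxx. Qed.

Let modulus_term_ge0 (x : int -> K^o) j k : 0 <= a j k * modulus (x j).
Proof. by rewrite mulr_ge0 ?modulus_ge0. Qed.

Definition canonical_vector (j : int) : int -> K^o := fun i => (i == j)%:R.

Lemma esum_canonical_vector (c : K) j k : p != 0 ->
  (\esum_(i in [set: int])
    ((a i k * modulus ((c *: canonical_vector j) i)) `^ p)%:E =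
   ((a j k * modulus c) `^ p)%:E)%E.
Proof.
move=> pn0; pose f i := ((a i k * modulus ((c *: canonical_vector j) i)) `^ p)%:E.
have -> : ((a j k * modulus c) `^ p)%:E = f j.
  by rewrite /f fctE /canonical_vector eqxx /GRing.scale /= mulr1.
rewrite -(@esum_set1 R int j f) ?lee_fin ?powR_ge0 // [RHS]esum_mkcond.
apply: eq_esum => i _; case: ifPn => //; rewrite notin_setE => /eqP/negPf ij.
by rewrite fctE /canonical_vector ij scaler0 modulus0 mulr0 powR0.
Qed.

Lemma canonical_vector_kothe j : canonical_vector j \in kothe_space p a.
Proof.
apply/asboolP; case: eqVneq => p0.
  move=> k eps e0; exists `|j|.+1 => i ij; rewrite /canonical_vector.
  by case: eqVneq ij => [->|_ _]; rewrite ?ltnn // modulus0 mulr0.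
move=> k; rewrite -[canonical_vector j]scale1r esum_canonical_vector //.
exact: ltry.
Qed.

(** Each coordinate contributes at most the whole supremum or sum.  In a real
    supremum or in the finite part of a sum this needs boundedness, which is
    where membership in the space enters; for [p = 0] all terms beyond some [N]
    are below [1] and the others are bounded by their sum. *)
Lemma kothe_coordinate_le k (x : int -> K^o) j : x \in kothe_space p a ->
  a j k * modulus (x j) <= kothe_seminorm p a k x.
Proof.
move=> /asboolP; rewrite /kothe_seminorm; case: eqVneq => p0 hx.
  apply: ub_le_sup; last by exists j.
  have [N hN] := hx k 1 ltr01.
  exists (1 + \sum_(0 <= i < N) (a i k * modulus (x i)
    + a (- i%:Z) k * modulus (x (- i%:Z)))) => _ [i _ <-].
  have s0 (P : pred nat) : 0 <= \sum_(0 <= i < N | P i) (a i k * modulus (x i)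
    + a (- i%:Z) k * modulus (x (- i%:Z))).
    by apply: sumr_ge0 => l _; rewrite addr_ge0 ?modulus_term_ge0.
  have [/hN/ltW h|iN] := leqP N `|i|.
    by apply: (le_trans h); rewrite lerDl.
  rewrite (bigD1_seq `|i|%N) ?mem_index_iota ?iota_uniq //= addrCA ler_wpDr //.
    by rewrite addr_ge0.
  have [iE|iE] : i = `|i|%N%:Z \/ i = - `|i|%N%:Z by lia.
  - by rewrite -iE lerDl modulus_term_ge0.
  - by rewrite -iE lerDr modulus_term_ge0.
have p1 := p_neq0 p0.
have fin := hx k; set s := esum _ _ in fin *.
have s0 : (0 <= s)%E by apply: esum_ge0 => i _; rewrite lee_fin powR_ge0.
have -> : a j k * modulus (x j) = ((a j k * modulus (x j)) `^ p) `^ p^-1.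
  by rewrite -powRrM divff // powRr1 // modulus_term_ge0.
rewrite ge0_ler_powR ?nnegrE ?powR_ge0 ?fine_ge0 ?invr_ge0 ?(le_trans ler01) //.
rewrite -lee_fin fineK ?ge0_fin_numE //.
apply: esum_ge; exists [set j]; first by split.
by rewrite fsbig_set1.
Qed.

Lemma kothe_seminorm_ge0 k (x : int -> K^o) : x \in kothe_space p a ->
  0 <= kothe_seminorm p a k x.
Proof.
by move=> hx; apply: le_trans (kothe_coordinate_le k 0 hx).
Qed.

Lemma kothe_seminorm_canonical_vector k (c : K) j :
  kothe_seminorm p a k (c *: canonical_vector j) = modulus c * a j k.
Proof.
rewrite mulrC /kothe_seminorm; case: eqVneq => p0.
  apply/eqP; rewrite eq_le; apply/andP; split.
    apply: ge_sup; first by eexists; exists j.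
    move=> _ [i _ <-]; rewrite fctE /canonical_vector /GRing.scale /=.
    case: eqVneq => [->|_]; first by rewrite mulr1.
    by rewrite mulr0 modulus0 mulr0 mulr_ge0 ?modulus_ge0.
  apply: ub_le_sup; last first.
    by exists j => //; rewrite fctE /canonical_vector eqxx /GRing.scale /= mulr1.
  exists (a j k * modulus c) => _ [i _ <-].
  rewrite fctE /canonical_vector /GRing.scale /=.
  case: eqVneq => [->|_]; first by rewrite mulr1.
  by rewrite mulr0 modulus0 mulr0 mulr_ge0 ?modulus_ge0.
rewrite esum_canonical_vector //= -powRrM divff // powRr1 //.
by rewrite mulr_ge0 ?modulus_ge0.
Qed.

End KotheSpaces.

(** * The characterization of average expansivity *)

Theorem mainTheorem3 (R : realType) (b : scalar_field) :
  (forall (S : pred (int -> (scalars R b)^o)) (X : seqTvsType S)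
      (e : int -> X) (p : nat -> X -> R) (w : int -> scalars R b)
      (F : invertible_operator X),
    frechet_sequence_space X ->
    canonical_basis e ->
    (forall k, seminorm (p k)) ->
    (forall k x, p k x <= p k.+1 x) ->
    induces_topology p ->
    (forall j, w j != 0) ->
    (forall x : X, \val (F x) = forward_shift w (\val x)) ->
    average_expansive p F <->
    exists k : nat,
      sup_pos (fun n => n%:R^-1 * \sum_(1 <= j < n.+1)
        modulus (\prod_(0 <= i < j) w i%:Z) * p k (e j%:Z)) = +oo%E \/
      sup_pos (fun n => n%:R^-1 * \sum_(1 <= j < n.+1)
        p k (e (- j%:Z)) / modulus (\prod_(1 <= i < j.+1) w (- i%:Z))) = +oo%E)
  /\
  (forall (p : R) (a : int -> nat -> R)
      (X : seqTvsType (@kothe_space R b p a)) (w : int -> scalars R b)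
      (F : invertible_operator X),
    p = 0 \/ 1 <= p ->
    kothe_matrix a ->
    induces_topology (fun k (x : X) => kothe_seminorm p a k (\val x)) ->
    (forall j, w j != 0) ->
    (forall x : X, \val (F x) = forward_shift w (\val x)) ->
    average_expansive (fun k (x : X) => kothe_seminorm p a k (\val x)) F <->
    exists k : nat,
      sup_pos (fun n => n%:R^-1 * \sum_(1 <= j < n.+1)
        a j%:Z k * modulus (\prod_(0 <= i < j) w i%:Z)) = +oo%E \/
      sup_pos (fun n => n%:R^-1 * \sum_(1 <= j < n.+1)
        a (- j%:Z) k / modulus (\prod_(1 <= i < j.+1) w (- i%:Z))) = +oo%E).
Proof.
split.
  move=> S X e p w F Xseq eb psn pS pind w0 Fw.
  apply: (average_expansive_shift w0 Fw (e := e) (h := fun k j => p k (e j))).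
  - by case: eb.
  - by move=> k c j; rewrite (seminormZ (psn k)).
  - by move=> k x; apply: seminorm_ge0.
  - exact: (basis_terms_equicontinuous Xseq eb psn pS pind).
move=> p a X w F p01 aK pind w0 Fw.
pose e j : X := Sub (@canonical_vector R b j)
  (canonical_vector_kothe b p a j).
have xS (x : X) : (\val x : int -> (scalars R b)^o) \in kothe_space p a := valP x.
rewrite (average_expansive_shift w0 Fw (e := e) (h := fun k j => a j k)).
- have comm k : (fun n => n%:R^-1 * \sum_(1 <= j < n.+1)
      modulus (\prod_(0 <= i < j) w i%:Z) * a j%:Z k) =
    (fun n => n%:R^-1 * \sum_(1 <= j < n.+1)
      a j%:Z k * modulus (\prod_(0 <= i < j) w i%:Z)).
    by apply/funext => n; congr (_ * _); apply: eq_bigr => j _; rewrite mulrC.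
  by split=> -[k hk]; exists k; move: hk; rewrite comm.
- by move=> j i; rewrite SubK.
- by move=> k c j; rewrite GRing.valZ SubK kothe_seminorm_canonical_vector.
- by move=> k x; apply: kothe_seminorm_ge0.
- move=> k; exists k, 1; split => // x j; rewrite mul1r mulrC.
  exact: kothe_coordinate_le.
Qed.
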